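(* Let $\mathcal{L}$ be a linear space of real symmetric $n\times n$ matrices whose eigenvalues are $\mathbb{Q}$-linearly independent. Then $$\deg \mathrm{GV}(\mathcal{L}) \leqslant n^{\binom{n+1}{2}+2n}.$$
   Context: $\mathbb{S}^n$ denotes the real vector space of real symmetric $n\times n$ matrices. An LSSM (linear space of symmetric matrices) is a linear subspace $\mathcal{L}=\mathrm{span}_{\mathbb{R}}(A_1,\ldots,A_d)\subset\mathbb{S}^n$, where $A_1,\ldots,A_d$ are linearly independent. The Gibbs manifold is $\mathrm{GM}(\mathcal{L})=\exp(\mathcal{L})=\{\exp(A): A\in\mathcal{L}\}$ (matrix exponential). The Gibbs variety $\mathrm{GV}(\mathcal{L})$ is the Zariski closure of $\mathrm{GM}(\mathcal{L})$ in $\mathbb{C}^{\binom{n+1}{2}}$, the space of complex symmetric $n\times n$ matrices. Its degree is the usual degree of an affine variety, i.e. the degree of its projective closure. Eigenvalues of $\mathcal{L}$: identify $\mathcal{L}$ with the matrix $y_1A_1+\cdots+y_dA_d$ with entries in the field $\mathbb{R}(y_1,\ldots,y_d)$, where $y_1,\ldots,y_d$ are indeterminates; the eigenvalues of $\mathcal{L}$ are the $n$ eigenvalues of this matrix (listed with multiplicity), which are elements of the algebraic closure $\overline{\mathbb{R}(y_1,\ldots,y_d)}$. *)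

(* Defs.v *)
From HB Require Import structures.
(* mpoly has to be imported before the topology files: their notations clash in
   the other order. *)
From mathcomp Require Import all_boot all_order all_algebra.
From mathcomp Require Import fraction mpoly complex.
From mathcomp Require Import boolp classical_sets reals topology normedtype.
From mathcomp Require Import sequences.

Set Implicit Arguments.
Unset Strict Implicit.
Unset Printing Implicit Defensive.

Import Order.TTheory GRing.Theory Num.Theory.
Import numFieldNormedType.Exports.

Local Open Scope classical_set_scope.
Local Open Scope ring_scope.

Section Varieties.
Variable C : fieldType.

Definition zariski_closure N (S : set ('I_N -> C)) : set ('I_N -> C) :=
  [set p | forall f : {mpoly C[N]},
     (forall q, S q -> f.@[q] = 0) -> f.@[p] = 0].

(* Subsets of P^N are given by the set of the homogeneous coordinate vectors in
   C^(N+1) of their points; A^N is the chart p |-> (1 : p). *)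

Definition homog_coord N (p : 'I_N -> C) : 'I_N.+1 -> C :=
  fun i => if unlift ord0 i is Some j then p j else 1.

Definition proj_closure N (V : set ('I_N -> C)) : set ('I_N.+1 -> C) :=
  [set p | (exists i, p i != 0) /\
     forall (s : nat) (f : dhomog N.+1 C s),
       (forall q, V q -> (f : {mpoly C[N.+1]}).@[homog_coord q] = 0) ->
       (f : {mpoly C[N.+1]}).@[p] = 0].

Section Hilbert.
Variables (N : nat) (Z : set ('I_N.+1 -> C)).

Definition is_vanishing_space s (U : {vspace dhomog N.+1 C s}) :=
  forall f : dhomog N.+1 C s,
    f \in U <-> (forall p, Z p -> (f : {mpoly C[N.+1]}).@[p] = 0).

(* The degree s part of the homogeneous ideal of Z. *)
Definition vanishing_forms s : {vspace dhomog N.+1 C s} :=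
  xget 0%VS [set U | @is_vanishing_space s U].

Lemma vanishing_formsP s : is_vanishing_space (vanishing_forms s).
Proof.
rewrite /vanishing_forms; apply: (@xgetPex _ 0%VS [set U | @is_vanishing_space s U]).
pose vanish (f : dhomog N.+1 C s) :=
  forall p, Z p -> (f : {mpoly C[N.+1]}).@[p] = 0.
pose good d := `[< exists U : {vspace dhomog N.+1 C s},
  (forall f, f \in U -> vanish f) /\ \dim U = d >].
have ex_good : exists d, good d.
  exists 0%N; apply/asboolP; exists 0%VS; split; last by rewrite dimv0.
  by move=> f; rewrite memv0 => /eqP -> p _; rewrite !linear0.
have ub d : good d -> (d <= \dim {:dhomog N.+1 C s})%N.
  by move=> /asboolP[U [_ <-]]; apply: dimvS; exact: subvf.
case: (ex_maxnP ex_good ub) => d /asboolP[U [UV dU]] maxd.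
exists U => f; split; first exact: UV.
move=> fV.
have /maxd : good (\dim (U + <[f]>)).
  apply/asboolP; exists (U + <[f]>)%VS; split => // g.
  case/memv_addP => u uU [_ /vlineP[k ->] ->] p Zp.
  by rewrite !linearD !linearZ /= (UV _ uU) // fV // mulr0 addr0.
rewrite -dU => le_dim.
have /eqP -> : U == (U + <[f]>)%VS by rewrite eqEdim addvSl.
by apply: (subvP (addvSr _ _)); exact: memv_line.
Qed.

Definition hilbert_function s : nat :=
  (\dim {:dhomog N.+1 C s} - \dim (vanishing_forms s))%N.

Definition is_hilbert_poly (P : {poly rat}) :=
  exists s0 : nat, forall s : nat, (s0 <= s)%N ->
    P.[s%:R] = (hilbert_function s)%:R.

Lemma is_hilbert_poly_uniq P Q :
  is_hilbert_poly P -> is_hilbert_poly Q -> P = Q.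
Proof.
move=> [a Pa] [b Qb]; apply/eqP; rewrite -subr_eq0; apply/negP => /negP nz.
pose rs := [seq (maxn a b + i)%N%:R : rat | i <- iota 0 (size (P - Q))].
have := @max_poly_roots _ (P - Q) rs nz.
rewrite size_map size_iota ltnn => H; apply: notF; apply: H.
- apply/allP => _ /mapP[i _ ->]; rewrite rootE hornerD hornerN Pa ?Qb ?subrr //.
    by rewrite (leq_trans (leq_maxr a b)) ?leq_addr.
  by rewrite (leq_trans (leq_maxl a b)) ?leq_addr.
- rewrite map_inj_uniq ?iota_uniq // => i j /eqP.
  by rewrite eqr_nat eqn_add2l => /eqP.
Qed.

(* By the Hilbert-Serre theorem every Z has a Hilbert polynomial. *)
Definition hilbert_poly : {poly rat} := xget 0 [set P | is_hilbert_poly P].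

Definition proj_degree : rat :=
  ((size hilbert_poly).-1)`!%:R * lead_coef hilbert_poly.

End Hilbert.

Definition affine_degree N (V : set ('I_N -> C)) : rat :=
  proj_degree (proj_closure V).

End Varieties.

Section Gibbs.
Variables (R : realType) (n : nat).

Definition expmx (A : 'M[R]_n) : 'M[R]_n :=
  limn (series (fun k => (k`!%:R)^-1 *: A ^+ k)).

Definition gibbs_manifold (L : {vspace 'M[R]_n}) : set 'M[R]_n :=
  [set expmx A | A in [set A | A \in L]].

(* The positions on or above the diagonal: the binom(n+1, 2) coordinates of the
   space of symmetric matrices. *)
Definition sym_index : finType := {p : 'I_n * 'I_n | (p.1 <= p.2)%N}.

Lemma card_sym_index : #|{: sym_index}| = 'C(n.+1, 2).
Proof.
rewrite card_sig -sum1_card.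
rewrite (eq_bigl (fun p : 'I_n * 'I_n => xpredT p.1 && (p.1 <= p.2)%N)); last by [].
rewrite -(pair_big_dep xpredT (fun i j : 'I_n => (i <= j)%N) (fun _ _ => 1%N)) /=.
rewrite (exchange_big_dep xpredT) //= -bin2_sum big_nat_recl // add0n big_mkord.
apply: eq_bigr => j _; rewrite sum1_card.
have inj : injective (widen_ord (ltn_ord j)).
  by move=> x y /(congr1 val) /= /val_inj.
rewrite -[RHS]card_ord -(card_imset _ inj).
apply: eq_card => i; apply/idP/imsetP => [ij|[k _ ->]] /=.
  by exists (Ordinal (ij : (i < j.+1)%N)) => //; apply: val_inj.
exact: (leq_ord k).
Qed.

Definition sym_coord (T : Type) (X : 'M[T]_n) : 'I_#|{: sym_index}| -> T :=
  fun k => X (sval (enum_val k)).1 (sval (enum_val k)).2.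

Definition gibbs_variety (L : {vspace 'M[R]_n}) :
    set ('I_#|{: sym_index}| -> R[i]) :=
  zariski_closure
    [set sym_coord (map_mx (real_complex R) X) | X in gibbs_manifold L].

Definition generic_mx d (A : d.-tuple 'M[R]_n) :
    'M[{fraction {mpoly R[d]}}]_n :=
  \sum_(k < d) tofrac 'X_k *: map_mx (fun a : R => tofrac a%:MP) (tnth A k).

End Gibbs.

Definition is_algebraic_closure (F : fieldType) (K : closedFieldType)
    (iota : {rmorphism F -> K}) :=
  forall x : K, algebraicOver iota x.

Definition eigenvalues_in (F : fieldType) (K : closedFieldType)
    (iota : {rmorphism F -> K}) n (M : 'M[F]_n) (lambda : n.-tuple K) :=
  char_poly (map_mx iota M) = \prod_(x <- lambda) ('X - x%:P).

Definition rat_lin_indep (K : fieldType) n (v : n.-tuple K) :=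
  forall c : 'I_n -> rat,
    \sum_(k < n) ratr (c k) * tnth v k = 0 -> forall k, c k = 0.

(* Main.v *)
(* Over R, every polynomial in Y = y_1 A_1 + ... + y_d A_d takes the form
   sum_i z_i G_i, where G_i are the spectral projections of Y, and
   exp(tY) = sum_i e^(t mu_i) G_i.  A polynomial f of degree s that vanishes on
   the Gibbs manifold gives an exponential sum f(exp(tY)) = sum_a g_a e^(t a.mu)
   vanishing at all naturals t; if the exponents a.mu with |a| <= s are
   distinct, then all g_a are 0, so f vanishes on every sum_i z_i G_i, hence on
   every sum_(j<n) c_j Y^j.  Distinctness is a non-empty Zariski open condition
   on y, as the eigenvalues of the pencil are linearly independent over Q.  So
   the Gibbs variety is the closure of the image of the polynomial map
   (c, y) |-> sum_(j<n) c_j Y^j, of degree at most n in n + d variables.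

   The degree of the closure of the image of a polynomial map phi of degree n is
   at most n^r, where r is the rank of the group spanned by the leading exponents
   of the polynomials f o phi.  The Hilbert function at s counts the
   leading exponents that arise from forms f of degree s.  They have total degree
   at most n s and are determined by r of their coordinates, so there are at most
   (n s + r)^r / r! of them; products of r forms with independent leading
   exponents show that the Hilbert polynomial has degree exactly r. *)

Require Import Defs.
From HB Require Import structures.
From mathcomp Require Import all_boot all_order all_fingroup all_algebra.
From mathcomp Require Import fraction mpoly complex polyrcf spectral.
From mathcomp Require Import boolp classical_sets reals topology normedtype.
From mathcomp Require Import sequences exp.
From mathcomp Require Import lra zify.

Set Implicit Arguments.
Unset Strict Implicit.
Unset Printing Implicit Defensive.

Import Order.TTheory GRing.Theory Num.Theory.
Import numFieldNormedType.Exports.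

Local Open Scope ring_scope.

(** * Asymptotics of polynomials *)

(** Otherwise [p] would tend to minus infinity and be negative at large naturals. *)
Lemma lead_coef_ge0 (p : {poly rat}) s0 :
  (forall s, (s0 <= s)%N -> 0 <= p.[s%:R]) -> 0 <= lead_coef p.
Proof.
move=> p_ge0; rewrite leNgt; apply/negP => lt0.
have : 0 < lead_coef (- p) by rewrite lead_coefN oppr_gt0.
case/poly_pinfty_gt_lc => x hx.
have := hx ((maxn s0 (Num.bound `|x|))%:R).
have /[swap] /[apply] : x <= (maxn s0 (Num.bound `|x|))%:R :> rat.
  rewrite (le_trans (ler_norm x)) // ltW // (lt_le_trans (archi_boundP _)) //.
  by rewrite ler_nat leq_maxr.
have := p_ge0 _ (leq_maxl s0 (Num.bound `|x|)).
by rewrite hornerN lead_coefN; lra.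
Qed.

Lemma size_affine_exp (a b : rat) r :
  (size (((a *: 'X + b%:P) ^+ r)%R : {poly rat}) <= r.+1)%N.
Proof.
apply: leq_trans (size_poly_exp_leq _ _) _; rewrite ltnS.
rewrite -[leqRHS]mul1n leq_mul2r; apply/orP; right.
have : (size ((a *: 'X + b%:P)%R : {poly rat}) <= 2)%N.
  rewrite (leq_trans (size_polyD _ _)) // geq_max.
  rewrite (leq_trans (size_scale_leq _ _)) ?size_polyX //.
  by rewrite (leq_trans (size_polyC_leq1 _)).
by case: size => [|[|[]]].
Qed.

Lemma coef_affine_exp (a b : rat) r : ((a *: 'X + b%:P) ^+ r)`_r = a ^+ r.
Proof.
elim: r => [|r IHr]; first by rewrite !expr0 coef1.
rewrite !exprS mulrDl coefD -scalerAl coefZ coefXM IHr mul_polyC coefZ.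
by rewrite [_`_r.+1]nth_default ?mulr0 ?addr0 ?size_affine_exp.
Qed.

(** For [P] non-zero, the upper bound forces degree at most r and the lower bound degree at least r.
    Comparing the coefficients of s^r in the upper bound then bounds the leading coefficient; in
    lower degree it would give no such information. *)
Lemma degree_lead_coef_le (P : {poly rat}) r n k s0 :
  (forall s, (s0 <= s)%N -> 0 <= P.[s%:R]) ->
  (forall s, (s0 <= s)%N -> r`!%:R * P.[s%:R] <= ((n * s + r) ^ r)%N%:R) ->
  (forall s, (s0 <= s)%N -> ((s.+1) ^ r)%N%:R <= P.[(k * s)%N%:R]) ->
  (size P).-1`!%:R * lead_coef P <= (n ^ r)%N%:R.
Proof.
move=> P_ge0 P_le P_ge.
have r_gt0 : 0 < r`!%:R :> rat by rewrite ltr0n fact_gt0.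
have [->|nzP] := eqVneq P 0; first by rewrite lead_coef0 mulr0 ler0n.
have lP : 0 < lead_coef P.
  by rewrite lt_neqAle eq_sym lead_coef_eq0 nzP (lead_coef_ge0 P_ge0).
pose B : {poly rat} := (n%:R *: 'X + (r%:R)%:P) ^+ r.
have sB : (size B <= r.+1)%N by apply: size_affine_exp.
pose Q : {poly rat} := B - r`!%:R *: P.
have Q_ge0 : 0 <= lead_coef Q.
  apply: (@lead_coef_ge0 _ s0) => s /P_le.
  rewrite /Q /B !hornerE natrX natrD natrM; lra.
have szP : (size P <= r.+1)%N.
  rewrite leqNgt; apply/negP => ltP.
  have sP : (size B < size (- (r`!%:R *: P)))%N.
    by rewrite size_polyN size_scale ?lt0r_neq0 // (leq_ltn_trans sB).
  move: Q_ge0; rewrite /Q lead_coefDr // lead_coefN lead_coefZ oppr_ge0.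
  by rewrite pmulr_rle0 // leNgt lP.
(* In degree below r, the difference P(kX) - (X+1)^r would have leading coefficient -1 while being
   non-negative at all large s. *)
have szP' : (r < size P)%N.
  rewrite ltnNge; apply/negP => leP.
  have sPk : (size (P \Po (k%:R *: 'X))%R <= size P)%N.
    rewrite (leq_trans (size_comp_poly_leq _ _)) //.
    have kX : ((size (k%:R *: 'X : {poly rat})%R).-1 <= 1)%N.
      by rewrite -subn1 leq_subLR (leq_trans (size_scale_leq _ _)) ?size_polyX.
    rewrite -[ltnRHS]prednK ?size_poly_gt0 // ltnS.
    by rewrite (leq_trans (leq_mul (leqnn _) kX)) ?muln1.
  pose D := P \Po (k%:R *: 'X) - (1 *: 'X + 1%:P) ^+ r.
  have D_ge0 : 0 <= lead_coef D.
    apply: (@lead_coef_ge0 _ s0) => s /P_ge.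
    by rewrite /D !hornerE horner_comp !hornerE natrX natrM -natr1; lra.
  have sD : (size D <= r.+1)%N.
    rewrite (leq_trans (size_polyD _ _)) // geq_max size_polyN size_affine_exp.
    by rewrite andbT (leq_trans sPk) // ltnW.
  have Dr : D`_r = -1.
    rewrite /D coefD coefN coef_affine_exp expr1n nth_default ?sub0r //.
    exact: leq_trans sPk leP.
  have : size D = r.+1.
    apply/eqP; rewrite eqn_leq sD ltnNge; apply/negP => h.
    by move: Dr; rewrite nth_default //; lra.
  move=> eD; move: D_ge0; rewrite lead_coefE eD /= Dr; lra.
have eP : size P = r.+1 by apply/eqP; rewrite eqn_leq szP.
rewrite eP /= lead_coefE eP /=.
have Qr : Q`_r = (n ^ r)%N%:R - r`!%:R * P`_r.
  by rewrite /Q coefD coefN coefZ coef_affine_exp natrX.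
rewrite -subr_ge0 -Qr.
have [->//|nzQr] := eqVneq Q`_r 0.
have sQ : (size Q <= r.+1)%N.
  rewrite (leq_trans (size_polyD _ _)) // geq_max size_polyN sB.
  by rewrite size_scale ?lt0r_neq0 // eP.
have : size Q = r.+1.
  apply/eqP; rewrite eqn_leq sQ ltnNge; apply/negP => h.
  by move: nzQr; rewrite nth_default ?eqxx.
by move: Q_ge0; rewrite lead_coefE => /[swap] ->.
Qed.

(** * Hilbert functions and leading exponents *)

Section LinearInvariants.
Variables (C : fieldType) (N m s : nat) (phi : N.+1.-tuple {mpoly C[m]}).
Local Notation V := (dhomog N.+1 C s).

Section Coefficients.
Variables (k : nat) (E : 'I_k -> 'X_{1..m}).

Definition pullback_coeffs (f : V) : 'rV[C]_k :=
  \row_i ((f : {mpoly C[N.+1]}) \mPo phi)@_(E i).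

Lemma pullback_coeffs_is_linear : linear pullback_coeffs.
Proof.
move=> a f g; apply/rowP => i; rewrite !mxE /=.
by rewrite comp_mpolyD comp_mpolyZ mcoeffD mcoeffZ.
Qed.

HB.instance Definition _ :=
  GRing.isLinear.Build C V 'rV[C]_k _ pullback_coeffs pullback_coeffs_is_linear.
End Coefficients.

Section Combinations.
Variables (k : nat) (w : 'I_k -> V).

Definition comb (x : 'rV[C]_k) : V := \sum_i x 0 i *: w i.

Lemma comb_is_linear : linear comb.
Proof.
move=> a x y; rewrite /comb scaler_sumr -big_split /=; apply: eq_bigr => i _.
by rewrite !mxE scalerDl scalerA.
Qed.

HB.instance Definition _ :=
  GRing.isLinear.Build C 'rV[C]_k V _ comb comb_is_linear.
End Combinations.
End LinearInvariants.

Section Pullback.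
Variables (C : fieldType) (N m : nat) (phi : N.+1.-tuple {mpoly C[m]}).
Variable Z : set ('I_N.+1 -> C).
(** Only the homogeneous ideal matters for the Hilbert function, so this expresses that [Z] is the
    closure of the image of [phi]. *)
Hypothesis phiP : forall s (f : dhomog N.+1 C s),
  (forall p, Z p -> (f : {mpoly C[N.+1]}).@[p] = 0) <->
  (f : {mpoly C[N.+1]}) \mPo phi = 0.
Local Notation pb f := ((f : {mpoly C[N.+1]}) \mPo phi).

Lemma mem_vanishing_forms s (f : dhomog N.+1 C s) :
  (f \in vanishing_forms Z s) <-> pb f = 0.
Proof. by rewrite (vanishing_formsP Z f) phiP. Qed.

(** A pullback whose coefficients vanish at every possible leading exponent is 0, so [#|A|] linear
    conditions cut out a subspace of the vanishing forms. *)
Lemma hilbert_function_le_leads s (T : finType) (A : {set T})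
    (c : 'X_{1..m} -> T) :
  (forall f : dhomog N.+1 C s, pb f != 0 -> c (mlead (pb f)) \in A) ->
  (forall f g : dhomog N.+1 C s, pb f != 0 -> pb g != 0 ->
     c (mlead (pb f)) = c (mlead (pb g)) -> mlead (pb f) = mlead (pb g)) ->
  (hilbert_function Z s <= #|A|)%N.
Proof.
move=> cA c_inj.
(* [E] inverts [c] on the leading exponents that occur; elsewhere the default exponent 0 merely adds
   a condition. *)
pose E t := xget 0%MM [set a | exists f : dhomog N.+1 C s,
  [/\ pb f != 0, a = mlead (pb f) & c a = t]].
have Ec (f : dhomog N.+1 C s) : pb f != 0 -> E (c (mlead (pb f))) = mlead (pb f).
  move=> nzf; rewrite /E; case: xgetP => [a _ [g [nzg -> eg]]|/(_ (mlead (pb f)))].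
    exact: c_inj.
  by case; exists f.
pose psi := linfun (pullback_coeffs phi (fun i : 'I_#|A| => E (enum_val i)) (s := s)).
have kI : (lker psi <= vanishing_forms Z s)%VS.
  apply/subvP => f; rewrite memv_ker lfunE /= => /eqP/rowP psi0.
  apply/mem_vanishing_forms; apply/eqP/negPn/negP => nzf.
  have := psi0 (enum_rank_in (cA _ nzf) (c (mlead (pb f)))).
  rewrite !mxE enum_rankK_in ?cA // Ec // => /eqP.
  by rewrite mleadc_eq0 (negPf nzf).
rewrite /hilbert_function leq_subLR -(limg_ker_dim psi fullv) capfv.
rewrite leq_add ?dimvS //.
by rewrite (leq_trans (dimvS (subvf _))) // dimvf /dim /= mul1n.
Qed.

(** In a non-trivial combination the largest leading exponent cannot cancel, so the [w t] are
    independent modulo the vanishing forms. *)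
Lemma leads_le_hilbert_function s (T : finType) (w : T -> dhomog N.+1 C s) :
  (forall t, pb (w t) != 0) -> injective (fun t => mlead (pb (w t))) ->
  (#|T| <= hilbert_function Z s)%N.
Proof.
move=> w_neq0 w_inj.
pose theta := linfun (comb (fun i : 'I_#|T| => w (enum_val i))).
have pb_comb x : pb (theta x) = \sum_i x 0 i *: pb (w (enum_val i)).
  rewrite lfunE /= /comb linear_sum /= linear_sum /=; apply: eq_bigr => i _.
  by rewrite linearZ.
have theta0 x : pb (theta x) = 0 -> x = 0.
  move=> x0; apply/eqP/negPn/negP => /rV0Pn[i0 nzi0].
  pose L (i : 'I_#|T|) := mlead (pb (w (enum_val i))).
  case: (@Order.TotalTheory.arg_maxP _ _ _ i0 (fun i => x 0 i != 0) L nzi0) => i nzi maxi.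
  have /(congr1 (mcoeff (L i))) := x0.
  rewrite pb_comb mcoeff0 linear_sum /= (bigD1 i) //= big1 => [|j ji].
    by rewrite addr0 mcoeffZ => /eqP; rewrite mulf_eq0 (negPf nzi) mleadc_eq0 (negPf (w_neq0 _)).
  rewrite mcoeffZ; have [->|nzj] := eqVneq (x 0 j) 0; first by rewrite mul0r.
  rewrite mcoeff_gt_mlead ?mulr0 // lt_neqAle; apply/andP; split; last exact: maxi.
  by rewrite (inj_eq w_inj) (inj_eq enum_val_inj).
have inj_theta : lker theta = 0%VS.
  apply/eqP; rewrite -subv0; apply/subvP => x; rewrite memv_ker memv0 => /eqP x0.
  by rewrite (theta0 x) ?eqxx // x0 comp_mpoly0.
rewrite /hilbert_function leq_subRL ?dimvS ?subvf //.
have dim_img : \dim (limg theta) = #|T|.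
  by have := limg_ker_dim theta fullv; rewrite inj_theta capv0 dimv0 add0n dimvf /dim /= mul1n.
rewrite -dim_img addnC -dimv_disjoint_sum ?dimvS ?subvf //.
apply/eqP; rewrite -subv0; apply/subvP => _ /memv_capP[/memv_imgP[x _ ->]].
by move=> /mem_vanishing_forms/theta0 ->; rewrite linear0 memv0.
Qed.
End Pullback.

(** As [msize] is the degree plus one, and 0 at the zero polynomial, [msize p <= a.+1] means degree
    at most a, with p = 0 included. *)
Lemma msize_mul_leq (R : idomainType) m (p q : {mpoly R[m]}) a b :
  (msize p <= a.+1)%N -> (msize q <= b.+1)%N -> (msize (p * q)%R <= (a + b).+1)%N.
Proof.
have [->|nzp] := eqVneq p 0; first by rewrite mul0r msize0.
have [->|nzq] := eqVneq q 0; first by rewrite mulr0 msize0.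
by rewrite msizeM //; lia.
Qed.

Lemma msize_exp_leq (R : idomainType) m (p : {mpoly R[m]}) a k :
  (msize p <= a.+1)%N -> (msize (p ^+ k)%R <= (a * k).+1)%N.
Proof.
move=> sp; elim: k => [|k IHk]; first by rewrite expr0 msize1.
by rewrite exprS mulnS msize_mul_leq.
Qed.

Lemma msize_comp_homog (R : idomainType) N m n s (f : {mpoly R[N]})
    (phi : N.-tuple {mpoly R[m]}) :
  f \is s.-homog -> (forall i, (msize (tnth phi i) <= n.+1)%N) ->
  (msize (f \mPo phi) <= (n * s).+1)%N.
Proof.
move=> fs phi_n; rewrite comp_mpolyE (leq_trans (msize_sum _ _ _)) //.
apply/bigmax_leqP_seq => a fa _.
rewrite (leq_trans (mmeasureZ_le _ _ _)) //.
have <- : mdeg a = s := dhomog_mf fs fa.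
rewrite mdegE.
elim/big_rec2: _ => [|i k p _ sp]; first by rewrite msize1.
by rewrite mulnDr msize_mul_leq // msize_exp_leq.
Qed.

Lemma ffact_leq_expn n m : (n ^_ m <= n ^ m)%N.
Proof.
elim: m => [|m IHm]; first by rewrite ffactn0 expn0.
by rewrite ffactnSr expnSr leq_mul // leq_subr.
Qed.

Definition mnm_row m (a : 'X_{1..m}) : 'rV[rat]_m := \row_j (a j)%:R.

Lemma mnm_row_inj m : injective (@mnm_row m).
Proof.
move=> a b /rowP e; apply/mnmP => j.
by have := e j; rewrite !mxE => /eqP; rewrite eqr_nat => /eqP.
Qed.

(** [J] selects r independent columns; the resulting square submatrix is invertible. *)
Lemma row_free_coords (F : fieldType) r m (M : 'M[F]_(r, m)) : row_free M ->
  exists2 J : 'I_r -> 'I_m, injective J & forall u v : 'rV[F]_m,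
    (u <= M)%MS -> (v <= M)%MS -> (forall i, u 0 (J i) = v 0 (J i)) -> u = v.
Proof.
move=> freeM.
have fullM : row_full M^T by rewrite /row_full mxrank_tr.
exists (fullrankfun fullM); first exact: fullrankfun_inj.
set J := fullrankfun fullM.
have sel x i : (rowsub J M^T *m x^T) i 0 = (x *m M) 0 (J i).
  by rewrite !mxE; apply: eq_bigr => k _; rewrite !mxE mulrC.
move=> u v /submxP[x ->] /submxP[y ->] uv; congr (_ *m _).
apply: trmx_inj; apply: (can_inj (mulKmx (fullrowsub_unit fullM))).
by apply/colP => i; rewrite !sel.
Qed.

(** * The rank of the leading exponents bounds the degree *)

Section RankBound.
Variables (C : fieldType) (N m n : nat) (phi : N.+1.-tuple {mpoly C[m]}).
Variable Z : set ('I_N.+1 -> C).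
(** Hence multiplying a form by ['X_ord0] raises its degree without changing its pullback. *)
Hypothesis phi0 : tnth phi ord0 = 1.
Hypothesis phi_deg : forall i, (msize (tnth phi i) <= n.+1)%N.
Hypothesis phiP : forall s (f : dhomog N.+1 C s),
  (forall p, Z p -> (f : {mpoly C[N.+1]}).@[p] = 0) <->
  (f : {mpoly C[N.+1]}) \mPo phi = 0.
Implicit Type f : {mpoly C[N.+1]}.

Definition independent_leads r (k : 'I_r -> nat) (g : 'I_r -> {mpoly C[N.+1]}) :=
  [/\ forall i, g i \is (k i).-homog, forall i, g i \mPo phi != 0 &
      row_free (\matrix_i mnm_row (mlead (g i \mPo phi)))].

(** Take r maximal: a form whose leading exponent lies outside the row space could be prepended to
    the family. *)
Lemma max_independent_leads : exists r (k : 'I_r -> nat) g,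
  [/\ (r <= m)%N, independent_leads k g &
   forall s f, f \is s.-homog -> f \mPo phi != 0 ->
   (mnm_row (mlead (f \mPo phi)) <=
     (\matrix_i mnm_row (mlead (g i \mPo phi)) : 'M_(r, m)))%MS].
Proof.
pose good r := `[< exists (k : 'I_r -> nat) g, independent_leads k g >].
have ex_good : exists r, good r.
  exists 0%N; apply/asboolP; exists (fun=> 0%N), (fun=> 0).
  by split=> [[]|[]|] //; rewrite -row_leq_rank.
have ub r : good r -> (r <= m)%N.
  by move=> /asboolP[k [g [_ _]]]; rewrite -row_leq_rank => /leq_trans -> //; apply: rank_leq_col.
case: (ex_maxnP ex_good ub) => r goodr maxr.
have r_le := ub _ goodr; case/asboolP: goodr => k [g ind].
exists r, k, g; split => // s f fs nzf; apply/negPn/negP => notin.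
case: ind => gk nzg; set M := (X in row_free X) in notin * => freeM.
pose k' (i : 'I_r.+1) := if unlift ord0 i is Some j then k j else s.
pose g' (i : 'I_r.+1) := if unlift ord0 i is Some j then g j else f.
suff /maxr : good r.+1 by rewrite ltnn.
apply/asboolP; exists k', g'; split=> [i|i|].
- by rewrite /g' /k'; case: unliftP.
- by rewrite /g'; case: unliftP.
set M' := (X in row_free X).
have M'E : M' = col_mx (mnm_row (mlead (f \mPo phi))) M :> 'M_(1 + r, m).
  apply/row_matrixP => i; rewrite rowK; case: (split_ordP i) => j ->.
    rewrite rowKu row_id /g'; case: unliftP => [l /(congr1 val)|//].
    by rewrite /= ord1.
  rewrite rowKd rowK; congr (mnm_row (mlead (_ \mPo _))).
  have -> : rshift 1 j = lift ord0 j :> 'I_r.+1 by apply: val_inj.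
  by rewrite /g' liftK.
have : (M < mnm_row (mlead (f \mPo phi)) + M)%MS.
  rewrite /ltmx addsmxSr /=.
  by apply: contra notin; apply: submx_trans; apply: addsmxSl.
move=> /rank_ltmx; rewrite addsmxE (eqP freeM) => lt_rank.
by rewrite -row_leq_rank M'E.
Qed.

(** Leading exponents lie in a space of dimension r, so r coordinates determine them. These are
    naturals of sum at most n s, which leaves 'C(r + n s, r) choices. *)
Lemma hilbert_function_upper r (k : 'I_r -> nat) g : independent_leads k g ->
  (forall s f, f \is s.-homog -> f \mPo phi != 0 ->
   (mnm_row (mlead (f \mPo phi)) <=
     (\matrix_i mnm_row (mlead (g i \mPo phi)) : 'M_(r, m)))%MS) ->
  forall s, (r`! * hilbert_function Z s <= (n * s + r) ^ r)%N.
Proof.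
case=> _ _ freeM spanM s.
have [J J_inj JM] := row_free_coords freeM.
pose c (a : 'X_{1..m}) : r.-tuple 'I_(n * s).+1 := [tuple inord (a (J i)) | i < r].
have lead_deg (f : dhomog N.+1 C s) : val f \mPo phi != 0 ->
    (mdeg (mlead (val f \mPo phi)) <= n * s)%N.
  move=> nzf; rewrite -ltnS mlead_deg // msize_comp_homog //.
  exact: dhomog_is_dhomog.
have coord_le (a : 'X_{1..m}) : (mdeg a <= n * s)%N -> forall j, (a j <= n * s)%N.
  by move=> + j; apply: leq_trans; rewrite mdegE (bigD1 j) // leq_addr.
have := @hilbert_function_le_leads _ _ _ phi Z phiP s _
  [set t : r.-tuple 'I_(n * s).+1 | \sum_(i <- t) i <= n * s]%N c.
rewrite card_partial_ord_partitions => le.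
have {}le : (hilbert_function Z s <= 'C(r + n * s, r))%N.
  apply: le => [f nzf|f g' nzf nzg].
    rewrite inE big_tuple (leq_trans _ (lead_deg _ nzf)) //.
    rewrite (eq_bigr (fun i => mlead ((f : {mpoly _[_]}) \mPo phi) (J i))) => [|i _]; last first.
      by rewrite tnth_mktuple inordK // ltnS coord_le // lead_deg.
    rewrite mdegE [leqRHS](bigID (mem (codom J))) /= (leq_trans _ (leq_addr _ _)) //.
    have J_uniq : uniq (codom J) by rewrite map_inj_uniq ?enum_uniq.
    rewrite -(big_uniq _ J_uniq) /=.
    by rewrite big_map big_enum.
  move=> e; apply: mnm_row_inj; apply: JM => [||i].
  - exact: spanM (dhomog_is_dhomog f) nzf.
  - exact: spanM (dhomog_is_dhomog g') nzg.
  have := congr1 (fun t => val (tnth t i)) e; rewrite /= !tnth_mktuple !mxE.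
  by rewrite !inordK ?ltnS ?coord_le ?lead_deg // => ->.
(* Multiplied by r!, the binomial becomes a falling factorial with r factors, each at most n s +
   r. *)
rewrite (leq_trans (leq_mul (leqnn _) le)) // mulnC bin_ffact addnC.
exact: ffact_leq_expn.
Qed.

(** The products of the [g i ^+ b i] with all b_i <= s have leading exponents sum_i b_i e_i, where
    e_i is that of [g i]; these are distinct because the e_i are independent. *)
Lemma hilbert_function_lower r (k : 'I_r -> nat) g : independent_leads k g ->
  forall s, (s.+1 ^ r <= hilbert_function Z ((\sum_i k i).+1 * s))%N.
Proof.
case=> gk nzg freeM s.
pose T := {ffun 'I_r -> 'I_s.+1}.
(* Powers of ['X_ord0] bring all products to one degree. The extra factor of degree s makes the
   multiplier of s positive, so that this degree is at least s. *)
pose w (b : T) : {mpoly C[N.+1]} :=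
  'X_ord0 ^+ s * \prod_i (g i ^+ b i * 'X_ord0 ^+ (k i * (s - b i))).
have w_homog b : w b \is ((\sum_i k i).+1 * s).-homog.
  have X1 : ('X_ord0 : {mpoly C[N.+1]}) \is 1.-homog by rewrite dhomogX; apply/eqP/mdeg1.
  rewrite mulSn dhomogM //; first by rewrite -[X in X.-homog](mul1n s) dhomogMn.
  rewrite big_distrl /=.
  elim/big_rec2: _ => [|i p d _ pd]; first exact: dhomog1.
  rewrite dhomogM //.
  have -> : (k i * s = k i * b i + 1 * (k i * (s - b i)))%N.
    by rewrite mul1n -mulnDr subnKC // -ltnS.
  by rewrite dhomogM ?dhomogMn.
have pb_w b : w b \mPo phi = \prod_i (g i \mPo phi) ^+ b i.
  have X0 : 'X_ord0 \mPo phi = 1 by rewrite comp_mpolyXU -tnth_nth.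
  rewrite rmorphM rmorphXn /= X0 expr1n mul1r rmorph_prod; apply: eq_bigr => i _.
  by rewrite rmorphM !rmorphXn /= X0 expr1n mulr1.
have nzb b i : (g i \mPo phi) ^+ b != 0 by rewrite expf_neq0.
have card_T : #|T| = (s.+1 ^ r)%N by rewrite card_ffun !card_ord.
rewrite -card_T.
apply: (leads_le_hilbert_function phiP (w := fun b => DHomog (w_homog b))) => [b|b b'] /=.
  by rewrite pb_w; apply/prodf_neq0.
rewrite !pb_w !mlead_prod // => e.
pose x (b : T) : 'rV[rat]_r := \row_i (b i)%:R.
have lead_w (b0 : T) : mnm_row (\sum_i mlead ((g i \mPo phi) ^+ b0 i))%MM =
    x b0 *m \matrix_i mnm_row (mlead (g i \mPo phi)).
  apply/rowP => j; rewrite !mxE mnm_sumE natr_sum; apply: eq_bigr => i _.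
  by rewrite !mxE mleadX // mulmnE natrM mulrC.
have /(row_free_inj freeM) /rowP exb : x b *m \matrix_i mnm_row (mlead (g i \mPo phi)) =
    x b' *m \matrix_i mnm_row (mlead (g i \mPo phi)) by rewrite -!lead_w e.
apply/ffunP => i; apply: val_inj; have := exb i; rewrite !mxE => /eqP.
by rewrite eqr_nat => /eqP.
Qed.

Lemma proj_degree_le : exists2 r, (r <= m)%N & proj_degree Z <= (n ^ r)%N%:R.
Proof.
have [r [k [g [r_le ind spanM]]]] := max_independent_leads.
exists r => //; rewrite /proj_degree /hilbert_poly.
(* The second case is the default Hilbert polynomial 0, of degree value 0. *)
case: xgetP => [P _ [s0 hP]|_]; last by rewrite lead_coef0 mulr0 ler0n.
apply: (@degree_lead_coef_le P r n (\sum_i k i).+1 s0) => s s0_le.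
- by rewrite hP // ler0n.
- by rewrite hP // -natrM ler_nat (hilbert_function_upper ind).
- by rewrite hP ?(leq_trans s0_le) ?leq_pmull // ler_nat (hilbert_function_lower ind).
Qed.
End RankBound.

(** * Exponential sums and interpolation *)

(* The moments of the weights [g@_a] at the points [\prod_i w i ^+ a i] vanish;
   test them against a polynomial that kills all these points but one. *)
Lemma mpoly_eq0_powers (F : idomainType) n (g : {mpoly F[n]}) (w : 'I_n -> F) :
  {in msupp g &, injective (fun a : 'X_{1..n} => \prod_i w i ^+ a i)} ->
  (forall j, g.@[fun i => w i ^+ j] = 0) -> g = 0.
Proof.
move=> x_inj g0; pose x (a : 'X_{1..n}) := \prod_i w i ^+ a i.
have moment (p : {poly F}) : \sum_(a <- msupp g) g@_a * p.[x a] = 0.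
  under eq_bigr do rewrite horner_coef mulr_sumr.
  rewrite exchange_big /= big1 // => j _.
  have /(congr1 ( *%R p`_j)) := g0 j.
  rewrite mulr0 mevalE mulr_sumr => e; rewrite -[RHS]e; apply: eq_bigr => a _.
  rewrite mulrCA; congr (_ * (_ * _)); rewrite -prodrXl; apply: eq_bigr => i _.
  by rewrite -!exprM mulnC.
apply/eqP/negPn/negP => nzg; have lead_g := mlead_supp nzg.
have := moment (\prod_(b <- msupp g | b != mlead g) ('X - (x b)%:P)).
rewrite (bigD1_seq (mlead g)) ?msupp_uniq //= [X in _ + X]big_seq_cond.
rewrite [X in _ + X]big1 => [|a /andP[ga a_lead]].
  apply/eqP; rewrite addr0 mulf_neq0 ?mleadc_eq0 // horner_prod.
  rewrite big_seq_cond prodf_seq_neq0; apply/allP => b _; apply/implyP => /andP[gb b_lead].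
  by rewrite !hornerE subr_eq0 eq_sym; apply: contra b_lead => /eqP/x_inj ->.
rewrite horner_prod -big_filter (bigD1_seq a) ?filter_uniq ?msupp_uniq //=.
  by rewrite hornerXsubC subrr mul0r mulr0.
by rewrite mem_filter a_lead.
Qed.

(** The lowest digit is the residue modulo [K]; removing it allows induction on n. *)
Lemma digits_inj K n (a b : 'I_n -> nat) :
  (forall i, (a i < K)%N) -> (forall i, (b i < K)%N) ->
  (\sum_(i < n) K ^ i * a i = \sum_(i < n) K ^ i * b i)%N -> a =1 b.
Proof.
elim: n a b => [|n IHn] a b aK bK; first by move=> _ [].
have K_gt0 : (0 < K)%N by apply: leq_ltn_trans (aK ord0).
have shift (c : 'I_n.+1 -> nat) : (\sum_(i < n.+1) K ^ i * c i =
    (\sum_(i < n) K ^ i * c (lift ord0 i)) * K + c ord0)%N.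
  rewrite big_ord_recl expn0 mul1n addnC big_distrl /=; congr (_ + _)%N.
  by apply: eq_bigr => i _; rewrite expnS -mulnA mulnC.
rewrite !shift => e i.
have e0 : a ord0 = b ord0.
  by have := congr1 (modn^~ K) e; rewrite !modnMDl !modn_small.
case: (unliftP ord0 i) => [j|] -> //.
have es : (\sum_(i < n) K ^ i * a (lift ord0 i) =
  \sum_(i < n) K ^ i * b (lift ord0 i))%N.
  by apply/eqP; rewrite -(eqn_pmul2r K_gt0) -(eqn_add2r (a ord0)) {2}e0 e.
exact: (IHn (fun j => a (lift ord0 j)) (fun j => b (lift ord0 j))).
Qed.

(* Kronecker substitution, at the points [2 ^ (K ^ i * j)] with [K] larger
   than all exponents. *)
Lemma mpoly_eq0_nat (F : numDomainType) n (p : {mpoly F[n]}) :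
  (forall t : 'I_n -> nat, p.@[fun i => (t i)%:R] = 0) -> p = 0.
Proof.
move=> p0; pose K := msize p.
apply: (@mpoly_eq0_powers _ _ p (fun i : 'I_n => (2 ^ (K ^ i))%N%:R)) => [a b pa pb|j].
  have prodE (c : 'X_{1..n}) : \prod_(i < n) (2 ^ (K ^ i))%N%:R ^+ c i =
      (2 ^ (\sum_(i < n) K ^ i * c i))%N%:R :> F.
    by rewrite expn_sum natr_prod; apply: eq_bigr => i _; rewrite -natrX -expnM.
  rewrite !prodE => /eqP; rewrite eqr_nat eqn_exp2l // => /eqP e.
  have expK (c : 'X_{1..n}) i : c \in msupp p -> (c i < K)%N.
    move=> /msize_mdeg_lt; apply: leq_ltn_trans.
    by rewrite mdegE (bigD1 i) // leq_addr.
  by apply/mnmP; apply: digits_inj e => i; apply: expK.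
by rewrite -(p0 (fun i => (2 ^ (K ^ i * j))%N)); apply: meval_eq => i; rewrite expnM [in RHS]natrX.
Qed.

(** Points may repeat, as eigenvalues do. A new point is handled by adding a multiple of the product
    of the X - y over the earlier points y. *)
Lemma interpolation (F : fieldType) (e : F -> F) (s : seq F) :
  exists2 p : {poly F}, (size p <= size s)%N & {in s, forall x, p.[x] = e x}.
Proof.
elim: s => [|x s [p sp pe]]; first by exists 0; rewrite ?size_poly0.
have [xs|xNs] := boolP (x \in s).
  exists p; first exact: leqW.
  by move=> y; rewrite inE => /orP[/eqP->|]; apply: pe.
pose q := \prod_(y <- s) ('X - y%:P).
have q_root y : (q.[y] == 0) = (y \in s) by rewrite -rootE root_prod_XsubC.
exists (p + ((e x - p.[x]) / q.[x]) *: q).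
  rewrite (leq_trans (size_polyD _ _)) // geq_max (leqW sp) /=.
  by rewrite (leq_trans (size_scale_leq _ _)) // size_prod_XsubC.
move=> y; rewrite inE !hornerE; have [->|_] := eqVneq y x.
  by move=> _; rewrite divfK ?q_root // addrC subrK.
by move=> /= ys; rewrite pe //; move: ys; rewrite -q_root => /eqP ->; rewrite mulr0 addr0.
Qed.

(** * Separation of linear combinations of roots *)

Section Separation.
Variables (n s : nat).
Local Notation T := {ffun 'I_n -> 'I_s.+1}.

(** Over a domain it is non-zero exactly when the values a.x, for exponent vectors a with entries at
    most s, are distinct. Taking all ordered pairs makes it symmetric in [x], with no sign. *)
Definition separation (E : comNzRingType) (x : 'I_n -> E) : E :=
  \prod_(p : T * T | p.1 != p.2) \sum_i ((p.1 i)%:Z - (p.2 i)%:Z)%:~R * x i.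

Lemma rmorph_separation (E E' : comNzRingType) (h : {rmorphism E -> E'}) x :
  h (separation x) = separation (h \o x).
Proof.
rewrite rmorph_prod; apply: eq_bigr => p _; rewrite rmorph_sum.
by apply: eq_bigr => i _; rewrite rmorphM rmorph_int.
Qed.

Lemma separation_sym : separation (fun i => 'X_i : {mpoly int[n]}) \is symmetric.
Proof.
apply/issymP => t; rewrite (rmorph_separation (msym t)) /separation.
pose h (p : T * T) : T * T := ([ffun i => p.1 (t i)], [ffun i => p.2 (t i)]).
pose h' (p : T * T) : T * T :=
  ([ffun i => p.1 (t^-1 i)%g], [ffun i => p.2 (t^-1 i)%g]).
have hK : cancel h h'.
  by case=> a b; congr pair; apply/ffunP => i; rewrite !ffunE permKV.
have hK' : cancel h' h.
  by case=> a b; congr pair; apply/ffunP => i; rewrite !ffunE permK.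
rewrite [RHS](reindex h') /=; last by exists h => p _; rewrite ?hK ?hK'.
apply: eq_big => [p|p _].
  congr negb; apply/eqP/eqP => [->//|/ffunP e].
  by apply/ffunP => i; have := e (t i); rewrite !ffunE permK.
rewrite [RHS](reindex_inj (@perm_inj _ t)) /=; apply: eq_bigr => i _.
rewrite !ffunE permK msymX; congr (_ * 'X_[_]).
by apply/mnmP => j; rewrite mnmE !mnm1E (canF_eq (permK t)).
Qed.

Lemma separation_neq0 (E : idomainType) (x : 'I_n -> E) :
  (forall a b : T, a != b ->
     \sum_i ((a i)%:Z - (b i)%:Z)%:~R * x i != 0) <-> separation x != 0.
Proof.
split=> [sep|]; first by apply/prodf_neq0 => -[a b] /=; apply: sep.
by move=> /prodf_neq0 sep a b; apply: (sep (a, b)).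
Qed.

(* [separation] is symmetric, hence a polynomial in the coefficients of [chi]. *)
Lemma separation_of_roots (B : comNzRingType) (chi : {poly B}) :
  exists q : B, forall (E : idomainType) (h : {rmorphism B -> E}) (x : n.-tuple E),
    map_poly h chi = \prod_(c <- x) ('X - c%:P) -> h q = separation (tnth x).
Proof.
have [t [tE _]] := sym_fundamental separation_sym.
(* By Viete, this is the elementary symmetric polynomial of degree i + 1 in the roots. *)
pose e (i : 'I_n) := (-1) ^+ i.+1 * chi`_(n - i.+1).
exists (mmap intr e t) => E h x chiE.
have eE i : h (e i) = mmap intr (tnth x) (mesym n int i.+1).
  have := mroots_coeff x (lift ord0 i); rewrite -chiE coef_map lift0 => eh.
  rewrite rmorphM rmorphXn rmorphN1 /= eh mulrA -expr2 sqrr_sign mul1r.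
  rewrite /mesym !raddf_sum /=; apply/eq_bigr => a _.
  rewrite !rmorph_prod /=; apply/eq_bigr => j _.
  by rewrite mmapX mmap1U mevalXU.
transitivity (mmap intr (tnth x) (separation (fun i => 'X_i : {mpoly int[n]}))).
  rewrite -tE comp_mpolyE raddf_sum rmorph_sum /=; apply: eq_bigr => m _.
  rewrite mmapZ rmorphM rmorph_int; congr (_ * _).
  rewrite !rmorph_prod; apply: eq_bigr => i _.
  by rewrite !rmorphXn /= eE tnth_mktuple.
rewrite (rmorph_separation (mmap intr (tnth x))); apply: eq_bigr => p _.
by apply: eq_bigr => i _; rewrite /= mmapX mmap1U.
Qed.
End Separation.

(** * Exponentials of symmetric matrices *)

Section SpectralDecomposition.
Variable R : rcfType.
Local Notation C := R[i].
Local Notation toC := (real_complex R).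

Lemma diag_mx_expr n (D : 'rV[C]_n) l :
  diag_mx D ^+ l = diag_mx (\row_i D 0 i ^+ l).
Proof.
elim: l => [|l IHl].
  rewrite expr0; apply/matrixP => i j; rewrite !mxE.
  by rewrite expr0; case: eqP.
rewrite exprS IHl; rewrite -[LHS]/(_ *m _) mulmx_diag; congr diag_mx.
by apply/rowP => i; rewrite !mxE exprS.
Qed.

Lemma char_poly_conj n (P D : 'M[C]_n) : P \in unitmx ->
  char_poly (invmx P *m D *m P) = char_poly D.
Proof.
move=> uP; have detP : \det (map_mx polyC P) != 0.
  by rewrite det_map_mx polyC_eq0 -unitfE -unitmxE.
apply: (mulfI detP); rewrite [RHS]mulrC /char_poly -!det_mulmx; congr (\det _).
rewrite mulmxBr mulmxBl scalar_mxC -!map_mxM; congr (_ - map_mx _ _).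
by rewrite !mulmxA mulmxV // mul1mx.
Qed.

Lemma expr_conj n (P D : 'M[C]_n) l : P \in unitmx ->
  (invmx P *m D *m P) ^+ l = invmx P *m D ^+ l *m P.
Proof.
move=> uP; elim: l => [|l IHl].
  by rewrite !expr0 -[1 in RHS]/(1%:M) mulmx1 mulVmx.
rewrite !exprS IHl -[LHS]/(_ *m _) -[D * _]/(_ *m _).
by rewrite !mulmxA mulmxK.
Qed.

(* The [G i] are the real parts of the spectral projections of a unitary
   diagonalisation over [R[i]]. *)
Lemma sym_power_sums n (Y : 'M[R]_n) : Y^T = Y ->
  exists (mu : 'I_n -> R) (G : 'I_n -> 'M[R]_n),
    char_poly Y = \prod_i ('X - (mu i)%:P) /\
    forall l, Y ^+ l = \sum_i mu i ^+ l *: G i.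
Proof.
move=> symY; pose YC := map_mx toC Y.
have hermY : YC \is hermsymmx.
  apply: realsym_hermsym; first by apply/is_hermitianmxP; rewrite expr0 scale1r map_mx_id // map_trmx symY.
  by apply/mxOverP => i j; rewrite mxE complex_real.
have /orthomx_spectralP := hermitian_normalmx hermY.
have /mxOverP := hermitian_spectral_diag_real hermY.
have := spectral_unit YC.
move: (spectralmx YC) (spectral_diag YC) => P D P_unit D_real YE.
pose mu i := complex.Re (D 0 i).
have muE i : D 0 i = (mu i)%:C%C by rewrite RRe_real.
exists mu, (fun i => \matrix_(a, b) complex.Re (invmx P a i * P i b)); split.
  apply: (map_poly_inj toC).
  rewrite map_char_poly -/YC YE char_poly_conj //.
  rewrite char_poly_trig ?diag_mx_is_trig // rmorph_prod; apply: eq_bigr => i _.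
  by rewrite rmorphB /= map_polyX map_polyC /= mxE eqxx muE.
move=> l; apply/matrixP => a b.
have YCl : YC ^+ l = invmx P *m diag_mx (\row_i D 0 i ^+ l) *m P.
  rewrite -diag_mx_expr -(expr_conj _ _ P_unit).
  by congr (_ ^+ l).
(* Real parts may be taken termwise, since the factors [mu i ^+ l] are real. *)
have -> : (Y ^+ l) a b = complex.Re ((YC ^+ l) a b).
  by rewrite /YC -rmorphXn mxE.
rewrite YCl mxE raddf_sum summxE; apply: eq_bigr => i _.
rewrite !mxE (bigD1 i) //= big1 => [|j /negPf ji]; last first.
  by rewrite !mxE ji mulr0.
rewrite addr0 !mxE eqxx muE /= -rmorphXn mulr1n.
rewrite mulrAC mulrC; case: (_ * P i b) => x y /=.
by rewrite mul0r subr0.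
Qed.
End SpectralDecomposition.

Section Exponential.
Variables (R : realType) (n : nat).

(** The partial sums combine scalar exponential series with fixed matrices, so the limit passes to
    the scalars. *)
Lemma expmx_power_sums m (X : 'M[R]_n) (mu : 'I_m -> R) (G : 'I_m -> 'M[R]_n) :
  (forall l, X ^+ l = \sum_i mu i ^+ l *: G i) ->
  expmx X = \sum_i expR (mu i) *: G i.
Proof.
move=> XE; apply: cvg_lim; first exact: norm_hausdorff.
have -> : series (fun k => (k`!%:R)^-1 *: X ^+ k) =
    (fun k => \sum_i series (exp_coeff (mu i)) k *: G i).
  apply/funext => k; rewrite /series /=.
  under [RHS]eq_bigr do rewrite scaler_suml.
  rewrite exchange_big /=; apply: eq_bigr => j _.
  rewrite XE scaler_sumr; apply: eq_bigr => i _.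
  by rewrite scalerA mulrC.
apply: cvg_big => [|i _]; first exact: add_continuous.
apply: cvgZr_tmp; exact: is_cvg_series_exp_coeff.
Qed.
End Exponential.

(** * The parametrised pencil *)

Section Closure.
Variables (C : fieldType) (N : nat).

(** Setting the coordinate 0 to 1 turns a form into an affine polynomial; if that vanishes on [S],
    it vanishes on the Zariski closure of [S]. *)
Lemma closure_vanishing (S : set ('I_N -> C)) s (f : dhomog N.+1 C s) :
  (forall p, proj_closure (zariski_closure S) p ->
     (f : {mpoly C[N.+1]}).@[p] = 0) <->
  (forall q, S q -> (f : {mpoly C[N.+1]}).@[homog_coord q] = 0).
Proof.
split=> [f0 q Sq|f0 p [_]].
  apply: f0; split; first by exists ord0; rewrite /homog_coord unlift_none oner_neq0.
  by move=> t g; apply=> h; apply.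
apply=> q Vq.
pose dehom : N.+1.-tuple {mpoly C[N]} :=
  [tuple if unlift ord0 i is Some j then 'X_j else 1 | i < N.+1].
have dehomE r : ((f : {mpoly C[N.+1]}) \mPo dehom).@[r] =
    (f : {mpoly C[N.+1]}).@[homog_coord r].
  rewrite comp_mpoly_meval; apply: meval_eq => i; rewrite tnth_mktuple /homog_coord.
  by case: unliftP => [j _|_]; rewrite ?mevalXU ?meval1.
by rewrite -dehomE; apply: Vq => r Sr; rewrite dehomE f0.
Qed.
End Closure.

(** * Coordinates on symmetric matrices *)

Section SymCoordinates.
Variable n : nat.
Local Notation N := #|{: sym_index n}|.

(** Unlike [homog_coord], this allows entries in a polynomial ring, so that a matrix of polynomials
    yields a map to substitute into forms. *)
Definition homog_sym (E : comNzRingType) (X : 'M[E]_n) : 'I_N.+1 -> E :=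
  fun i => if unlift ord0 i is Some j then sym_coord X j else 1.

Lemma meval_comp_sym (C : fieldType) m (X : 'M[{mpoly C[m]}]_n)
    (f : {mpoly C[N.+1]}) (v : 'I_m -> C) :
  (f \mPo [tuple homog_sym X i | i < N.+1]).@[v] =
  f.@[homog_coord (sym_coord (map_mx (meval v) X))].
Proof.
rewrite comp_mpoly_meval; apply: meval_eq => i.
rewrite tnth_mktuple /homog_coord /homog_sym.
by case: unliftP => [j _|_]; rewrite ?meval1 // /sym_coord mxE.
Qed.

Lemma msize_homog_sym (C : fieldType) m (X : 'M[{mpoly C[m]}]_n) b :
  (forall i j, (msize (X i j) <= b.+1)%N) ->
  forall i, (msize (tnth [tuple homog_sym X i | i < N.+1] i) <= b.+1)%N.
Proof.
move=> Xb i; rewrite tnth_mktuple /homog_sym.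
by case: unliftP => [j _|_]; rewrite ?msize1 // /sym_coord.
Qed.

Section SymRow.
Variable F : fieldType.

Definition sym_row (X : 'M[F]_n) : 'rV[F]_N := \row_i sym_coord X i.

Lemma sym_row_is_linear : linear sym_row.
Proof. by move=> a X Y; apply/rowP => i; rewrite !mxE /sym_coord !mxE. Qed.

HB.instance Definition _ :=
  GRing.isLinear.Build F 'M[F]_n 'rV[F]_N _ sym_row sym_row_is_linear.

Lemma sym_row_eq0 (X : 'M[F]_n) : X^T = X -> sym_row X = 0 -> X = 0.
Proof.
move=> symX /rowP X0.
have Xle (a b : 'I_n) : (a <= b)%N -> X a b = 0.
  move=> ab; pose p : sym_index n := exist (fun q : 'I_n * 'I_n => (q.1 <= q.2)%N) (a, b) ab.
  by have := X0 (enum_rank p); rewrite !mxE /sym_coord enum_rankK.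
apply/matrixP => a b; rewrite [RHS]mxE; have [/Xle//|/ltnW/Xle ba] := leqP a b.
by rewrite -symX mxE.
Qed.
End SymRow.

(** The entries on or above the diagonal embed the span into a space of dimension 'C(n + 1, 2). *)
Lemma size_free_sym (F : fieldType) d (A : d.-tuple 'M[F]_n) :
  (forall k, (tnth A k)^T = tnth A k) -> free A -> (d <= 'C(n.+1, 2))%N.
Proof.
move=> symA /eqP dimA; rewrite size_tuple in dimA.
pose f := linfun (@sym_row F).
have sym_span X : X \in <<A>>%VS -> X^T = X.
  move=> /coord_span ->; rewrite raddf_sum; apply: eq_bigr => k _.
  by rewrite /= linearZ /= -tnth_nth symA.
have ker0 : (<<A>> :&: lker f)%VS = 0%VS.
  apply/eqP; rewrite -subv0; apply/subvP => X /memv_capP[/sym_span symX].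
  by rewrite memv_ker lfunE memv0 => /eqP/(sym_row_eq0 symX)/eqP.
have := limg_ker_dim f <<A>>; rewrite ker0 dimv0 add0n [in RHS]dimA => <-.
rewrite -card_sym_index (leq_trans (dimvS (subvf _))) //.
by rewrite dimvf /dim /= mul1n.
Qed.

End SymCoordinates.

(* [exprZn] only covers non-trivial rings, hence not ['M_0]. *)
Lemma scalemx_expr (E : comNzRingType) n (c : E) (X : 'M[E]_n) l :
  (c *: X) ^+ l = c ^+ l *: X ^+ l.
Proof.
elim: l => [|l IHl]; first by rewrite !expr0 scale1r.
by rewrite !exprS IHl -[LHS]/(_ *m _) -scalemxAl -scalemxAr scalerA.
Qed.

Section ParametrisedPencil.
Variables (R : realType) (n d : nat) (A : d.-tuple 'M[R]_n).
Local Notation C := R[i].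
Local Notation toC := (real_complex R).
Local Notation N := #|{: sym_index n}|.

Definition pencil (y : 'I_d -> R) : 'M[R]_n := \sum_k y k *: tnth A k.

(** With entries in the polynomial ring, it maps both to the generic matrix over the fraction field
    and to each real [pencil y]. *)
Definition poly_pencil : 'M[{mpoly R[d]}]_n :=
  \sum_k 'X_k *: map_mx (@mpolyC d R) (tnth A k).

Lemma meval_poly_pencil y : map_mx (meval y) poly_pencil = pencil y.
Proof.
rewrite raddf_sum; apply: eq_bigr => k _; apply/matrixP => i j.
by rewrite !mxE /= mevalM mevalXU mevalC.
Qed.

Lemma generic_mxE : generic_mx A = map_mx (@tofrac _) poly_pencil.
Proof.
rewrite raddf_sum; apply: eq_bigr => k _; apply/matrixP => i j.
by rewrite !mxE /= rmorphM.
Qed.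

Definition param_pencil : 'M[{mpoly C[n + d]}]_n :=
  \sum_k 'X_(rshift n k) *: map_mx (@mpolyC (n + d) C \o toC) (tnth A k).

(* The matrix [\sum_(j < n) c_j Y^j], where [c] and the coefficients [y] of
   the generic element [Y] of the pencil are indeterminates. *)
Definition param_mx : 'M[{mpoly C[n + d]}]_n :=
  \sum_(j < n) 'X_(lshift d j) *: param_pencil ^+ j.

Definition param_point (c : 'I_n -> R) (y : 'I_d -> R) : 'I_(n + d) -> C :=
  fun i => match split i with inl j => toC (c j) | inr k => toC (y k) end.

Lemma meval_param_mx c y : map_mx (meval (param_point c y)) param_mx =
  map_mx toC (\sum_(j < n) c j *: pencil y ^+ j).
Proof.
have pencilE : map_mx (meval (param_point c y)) param_pencil = map_mx toC (pencil y).
  rewrite !raddf_sum; apply: eq_bigr => k _; apply/matrixP => a b.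
  by rewrite !mxE /= mevalM mevalXU mevalC /param_point (unsplitK (inr k)) rmorphM.
rewrite !raddf_sum; apply: eq_bigr => j _ /=.
rewrite !map_mxZ /= mevalXU /param_point (unsplitK (inl j)); congr (_ *: _).
by rewrite !rmorphXn /= pencilE.
Qed.

(** The entries of Y^j have degree at most j <= n - 1, and the factor c_j adds one. *)
Lemma msize_param_mx i j : (msize (param_mx i j) <= n.+1)%N.
Proof.
have msize_sumM (I : finType) (F G : I -> {mpoly C[n + d]}) p q :
    (forall k, (msize (F k) <= p.+1)%N) -> (forall k, (msize (G k) <= q.+1)%N) ->
    (msize (\sum_k F k * G k)%R <= (p + q).+1)%N.
  move=> Fp Gq; rewrite (leq_trans (msize_sum _ _ _)) //.
  by apply/bigmax_leqP => k _; rewrite msize_mul_leq.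
have size_pencil a b : (msize (param_pencil a b) <= 2)%N.
  rewrite summxE (leq_trans (msize_sum _ _ _)) //; apply/bigmax_leqP => k _.
  by rewrite !mxE (@msize_mul_leq _ _ _ _ 1 0) // ?msizeX ?mdeg1 // msizeC leq_b1.
have size_pencil_exp l a b : (msize ((param_pencil ^+ l) a b) <= l.+1)%N.
  elim: l a b => [|l IHl] a b.
    by rewrite expr0 mxE; case: eqP; rewrite ?msize1 // msize0.
  by rewrite exprS -[_ * _]/(_ *m _) mxE; apply: (@msize_sumM _ _ _ 1).
rewrite summxE (leq_trans (msize_sum _ _ _)) //; apply/bigmax_leqP => k _.
rewrite mxE (leq_trans (@msize_mul_leq _ _ _ _ 1 k _ _)) // ?msizeX ?mdeg1 //.
by rewrite ltnS add1n.
Qed.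

Lemma pencil_span X : X \in <<A>>%VS -> exists y, X = pencil y.
Proof.
move=> /coord_span ->; exists (fun k => coord A k X).
by apply: eq_bigr => k _; rewrite -tnth_nth.
Qed.

Lemma mem_pencil y : pencil y \in <<A>>%VS.
Proof.
by apply: rpred_sum => k _; rewrite rpredZ // memv_span // mem_tnth.
Qed.

Hypothesis symA : forall k, (tnth A k)^T = tnth A k.

Lemma pencil_sym y : (pencil y)^T = pencil y.
Proof. by rewrite raddf_sum; apply: eq_bigr => k _; rewrite /= linearZ /= symA. Qed.

(** The c_j are the coefficients of a polynomial of degree below n that agrees with exp at the
    eigenvalues. *)
Lemma expmx_pencil y : exists c : 'I_n -> R,
  expmx (pencil y) = \sum_(j < n) c j *: pencil y ^+ j.
Proof.
have [mu [G [_ XE]]] := sym_power_sums (pencil_sym y).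
have [p sp pE] := interpolation expR [seq mu i | i <- enum 'I_n].
rewrite size_map size_enum_ord in sp.
exists (fun j => p`_j); rewrite (expmx_power_sums XE).
under [RHS]eq_bigr do rewrite XE scaler_sumr.
rewrite exchange_big /=; apply: eq_bigr => i _.
rewrite -pE ?map_f ?mem_enum // (horner_coef_wide _ sp) scaler_suml.
by apply: eq_bigr => j _; rewrite scalerA.
Qed.

Local Notation phi := [tuple homog_sym param_mx i | i < N.+1].

(** On the matrices sum_i z_i G_i, [f] becomes a polynomial [g] in z. It vanishes at z_i = e^(j
    mu_i) for all naturals j, as these points give exp(jY), so [mpoly_eq0_powers] yields g = 0. *)
Lemma vanish_param_at s (f : {mpoly C[N.+1]}) c y (mu : n.-tuple R)
    (G : 'I_n -> 'M[R]_n) :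
  f \is s.-homog ->
  (forall X, X \in <<A>>%VS ->
     f.@[homog_coord (sym_coord (map_mx toC (expmx X)))] = 0) ->
  (forall l, pencil y ^+ l = \sum_i tnth mu i ^+ l *: G i) ->
  separation s (tnth mu) != 0 ->
  (f \mPo phi).@[param_point c y] = 0.
Proof.
move=> f_homog f0 XE sep.
pose M : 'M[{mpoly C[n]}]_n := \sum_i 'X_i *: map_mx (@mpolyC n C \o toC) (G i).
have ME z : map_mx (meval (toC \o z)) M = map_mx toC (\sum_i z i *: G i).
  rewrite !raddf_sum; apply: eq_bigr => k _; apply/matrixP => a b.
  by rewrite !mxE /= mevalM mevalXU mevalC rmorphM.
pose g := f \mPo [tuple homog_sym M i | i < N.+1].
(* The exponents of [g] thus have entries at most s, the range covered by [separation s]. *)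
have g_size : (msize g <= s.+1)%N.
  rewrite -[s]mul1n; apply: msize_comp_homog => //; apply: msize_homog_sym => a b.
  rewrite summxE (leq_trans (msize_sum _ _ _)) //; apply/bigmax_leqP => k _.
  by rewrite !mxE (@msize_mul_leq _ _ _ _ 1 0) // ?msizeX ?mdeg1 // msizeC leq_b1.
have g0 : g = 0.
  apply: (@mpoly_eq0_powers _ _ g (fun i => toC (expR (tnth mu i)))) => [a b ga gb|j].
    have prodE (e : 'X_{1..n}) : \prod_i toC (expR (tnth mu i)) ^+ e i =
        toC (expR (\sum_i (e i)%:R * tnth mu i)).
      rewrite (big_morph expR (@expRD R) (@expR0 R)) rmorph_prod.
      by apply: eq_bigr => i _; rewrite expRM_natl rmorphXn.
    have e_le (e : 'X_{1..n}) i : e \in msupp g -> (e i < s.+1)%N.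
      move=> /msize_mdeg_lt /leq_trans /(_ g_size); apply: leq_ltn_trans.
      by rewrite mdegE (bigD1 i) // leq_addr.
    rewrite !prodE => /complexI/expR_inj ab_eq.
    pose ex (e : 'X_{1..n}) : {ffun 'I_n -> 'I_s.+1} := [ffun i => inord (e i)].
    have exE e i : e \in msupp g -> ex e i = e i :> nat.
      by move=> ge; rewrite ffunE inordK ?e_le.
    have [eab|] := eqVneq (ex a) (ex b).
      by apply/mnmP => i; rewrite -!exE // eab.
    move=> /((separation_neq0 _ _).2 sep) /eqP[].
    transitivity (\sum_i ((a i)%:R * tnth mu i - (b i)%:R * tnth mu i)).
      by apply: eq_bigr => i _; rewrite !exE // rmorphB mulrBl.
    by rewrite sumrB ab_eq subrr.
  have jX : j%:R *: pencil y \in <<A>>%VS by rewrite rpredZ // mem_pencil.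
  have := f0 _ jX.
  have jXE l : (j%:R *: pencil y) ^+ l = \sum_i (j%:R * tnth mu i) ^+ l *: G i.
    rewrite scalemx_expr XE scaler_sumr; apply: eq_bigr => i _.
    by rewrite scalerA exprMn.
  rewrite (expmx_power_sums jXE) -(ME (fun i => expR (j%:R * tnth mu i))).
  rewrite -meval_comp_sym -/g => <-; apply: meval_eq => i /=.
  by rewrite expRM_natl rmorphXn.
rewrite meval_comp_sym meval_param_mx.
have -> : \sum_(j < n) c j *: pencil y ^+ j =
    \sum_i (\sum_(j < n) c j * tnth mu i ^+ j) *: G i.
  under eq_bigr do rewrite XE scaler_sumr.
  rewrite exchange_big /=; apply: eq_bigr => i _; rewrite scaler_suml.
  by apply: eq_bigr => j _; rewrite scalerA.
by rewrite -ME -meval_comp_sym -/g g0 meval0.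
Qed.

Variables (K : closedFieldType) (iota : {rmorphism {fraction {mpoly R[d]}} -> K})
  (lambda : n.-tuple K).
Hypothesis lambdaP : eigenvalues_in iota (generic_mx A) lambda.
Hypothesis lambda_indep : rat_lin_indep lambda.

(** One [q], built from the characteristic polynomial of [poly_pencil], specialises both to
    [lambda], where independence over Q makes it non-zero, and to the real eigenvalues at each y. *)
Lemma generic_separation s : exists2 q : {mpoly R[d]}, q != 0 &
  forall y (mu : n.-tuple R),
    char_poly (pencil y) = \prod_(c <- mu) ('X - c%:P) ->
    q.@[y] = separation s (tnth mu).
Proof.
have [q qE] := separation_of_roots n s (char_poly poly_pencil).
exists q => [|y mu charE]; last first.
  by apply: (qE _ (meval y)); rewrite map_char_poly meval_poly_pencil.
pose h : {rmorphism {mpoly R[d]} -> K} :=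
  GRing.RMorphism.clone _ _ (iota \o @tofrac _) _.
have hq : h q = separation s (tnth lambda).
  apply: qE; rewrite /h map_poly_comp map_char_poly -generic_mxE.
  by rewrite map_char_poly.
suff : h q != 0 by apply: contraNneq => ->; rewrite rmorph0.
rewrite hq; apply/separation_neq0 => a b; apply: contraNneq => ab0.
have := lambda_indep (c := fun i => ((a i)%:Z - (b i)%:Z)%:~R).
have -> : \sum_k ratr ((a k)%:Z - (b k)%:Z)%:~R * tnth lambda k = 0.
  by rewrite -[RHS]ab0; apply: eq_bigr => i _; rewrite ratr_int.
move=> /(_ erefl) ab; apply/eqP/ffunP => i; apply: val_inj.
by have /eqP := ab i; rewrite intr_eq0 subr_eq0 => /eqP[].
Qed.

(** For the forward direction, the pullback of [f] vanishes at the real points where [q] does not.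
    Its product with [q] therefore vanishes at all natural points and is 0. *)
Lemma vanish_param s (f : {mpoly C[N.+1]}) : f \is s.-homog ->
  (forall X, X \in <<A>>%VS ->
     f.@[homog_coord (sym_coord (map_mx toC (expmx X)))] = 0) <->
  f \mPo phi = 0.
Proof.
move=> f_homog; split=> [f0|f0 X /pencil_span[y ->]]; last first.
  have [c ->] := expmx_pencil y.
  by rewrite -meval_param_mx -meval_comp_sym f0 meval0.
have [q nzq qE] := generic_separation s.
pose qC : {mpoly C[n + d]} :=
  map_mpoly toC q \mPo [tuple 'X_(rshift n k) | k < d].
have qC_eval c y : qC.@[param_point c y] = toC q.@[y].
  rewrite comp_mpoly_meval raddf_sum rmorph_sum; apply: eq_bigr => m _ /=.
  rewrite mevalM mevalC rmorphM; congr (_ * _); rewrite !rmorph_prod.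
  apply: eq_bigr => k _; rewrite !rmorphXn /= mevalXU tnth_mktuple mevalXU.
  by rewrite /param_point (unsplitK (inr k)).
have nz_qC : qC != 0.
  apply: contra_neq nzq => qC0; apply: mpoly_eq0_nat => t.
  have /esym/eqP := qC_eval (fun=> 0) (fun k => (t k)%:R).
  by rewrite qC0 meval0 fmorph_eq0 => /eqP.
suff /eqP : (f \mPo phi) * qC = 0 by rewrite mulf_eq0 (negPf nz_qC) orbF => /eqP.
apply: mpoly_eq0_nat => t.
pose c (j : 'I_n) : R := (t (lshift d j))%:R.
pose y (k : 'I_d) : R := (t (rshift n k))%:R.
rewrite (meval_eq (v2 := param_point c y)) => [|i]; last first.
  by rewrite /param_point -[in LHS](splitK i); case: (split i) => k /=; rewrite rmorph_nat.
rewrite mevalM qC_eval.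
have [->|nzqy] := eqVneq q.@[y] 0; first by rewrite rmorph0 mulr0.
have [mu [G [charE XE]]] := sym_power_sums (pencil_sym y).
pose mu_t := [tuple mu i | i < n].
rewrite (@vanish_param_at s f c y mu_t G) ?mul0r //.
- by move=> l; rewrite XE; apply: eq_bigr => i _; rewrite tnth_mktuple.
- by rewrite -(qE y) // charE big_tuple; apply: eq_bigr => i _; rewrite tnth_mktuple.
Qed.

Lemma gibbs_degree_le : free A ->
  affine_degree (gibbs_variety <<A>>%VS) <= (n ^ ('C(n.+1, 2) + 2 * n))%N%:R.
Proof.
move=> freeA.
have d_le := size_free_sym symA freeA.
have phi0 : tnth phi ord0 = 1 by rewrite tnth_mktuple /homog_sym unlift_none.
have [|r r_le] := proj_degree_le phi0 (msize_homog_sym msize_param_mx)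
    (Z := proj_closure (gibbs_variety <<A>>%VS)).
  move=> s f; rewrite closure_vanishing -(@vanish_param s) ?dhomog_is_dhomog //.
  split=> f0.
    by move=> X LX; apply: f0; exists (expmx X) => //; exists X.
  by move=> _ [_ [X LX <-] <-]; apply: f0.
move=> /le_trans; apply; rewrite ler_nat.
(* For n > 0, r <= n + d and d <= 'C(n + 1, 2) suffice. For n = 0 they force r = 0, and both sides
   are 0^0 = 1. *)
have [n0|n_gt0] := posnP n; last by rewrite leq_pexp2l //; lia.
have -> : r = 0%N by move: r_le d_le; rewrite n0 bin_small //; lia.
by rewrite expn0 n0.
Qed.
End ParametrisedPencil.

Theorem proposition2p7 (R : realType) (n d : nat) (A : d.-tuple 'M[R]_n)
    (K : closedFieldType) (iota : {rmorphism {fraction {mpoly R[d]}} -> K})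
    (lambda : n.-tuple K) :
  (forall k, (tnth A k)^T = tnth A k) ->
  free A ->
  is_algebraic_closure iota ->
  eigenvalues_in iota (generic_mx A) lambda ->
  rat_lin_indep lambda ->
  affine_degree (gibbs_variety <<A>>%VS)
    <= (n ^ ('C(n.+1, 2) + 2 * n))%N%:R.
Proof.
move=> symA freeA _ lambdaP lambda_indep.
exact (gibbs_degree_le symA lambdaP lambda_indep freeA).
Qed.
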